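(* Let $(G,p,\varepsilon)$ be a weaving in the plane and let $(G,p,\varepsilon')$ be its polar tensegrity, with signs $\varepsilon'_{ij}=\operatorname{sign}(s_{ij})\,\varepsilon_{ij}$. Then the weaving $(G,p,\varepsilon)$ is statically flat if and only if its polar tensegrity $(G,p,\varepsilon')$ is statically rigid.
   Context: Let $\rho:\mathbb{R}^2\to\mathbb{R}^2$ be the counter-clockwise rotation through $\pi/2$, and for nonzero $x\in\mathbb{R}^2$ let $\hat x=x/\|x\|$. Weaving. A weaving $(G,p,\varepsilon)$ consists of a finite simple graph $G=(V,E)$ with $V=\{1,\dots,n\}$ and $|E|=m$; a set of $n$ distinct lines $L_1,\dots,L_n$ in $\mathbb{R}^2$, none through the origin, where $L_i=\{x:\langle x,p_i\rangle=1\}$ for a nonzero $p_i\in\mathbb{R}^2$, such that $L_i$ and $L_j$ are not parallel whenever $ij\in E$; and a sign $\varepsilon_{ij}\in\{\pm1\}$ for each edge $ij$ with $i<j$ ($+1$ means $L_i$ passes over $L_j$ at their crossing point, $-1$ means $L_i$ passes under $L_j$). Set $\varepsilon_{ji}=-\varepsilon_{ij}$. For $ij\in E$ put $s_{ij}=1/\det[p_i\ p_j]$; the crossing point of $L_i$ and $L_j$ is $q_{ij}=s_{ij}\rho(p_i-p_j)=q_{ji}$. Statics of a weaving. A load on the weaving is a vector $f=(f_1,\dots,f_n)\in(\mathbb{R}^2)^n$, where $f_i=M_i\hat p_i-(T_i/\|p_i\|)\widehat{\rho(p_i)}$ encodes a moment $M_i$ about an axis through the origin orthogonal to $L_i$ and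 a vertical force $T_i$ applied to beam $L_i$ (every vector $f_i\in\mathbb{R}^2$ has this form). The load is an equilibrium load if $\sum_i f_i=0$ and $\sum_i\langle\rho(p_i),f_i\rangle=0$. A vector $\omega\in\mathbb{R}^E$ with symmetric entries $\omega_{ij}=\omega_{ji}$ resolves an equilibrium load $f$ if for every $i\in V$ $$f_i=\frac{1}{\|p_i\|}\sum_{j:\,ij\in E}\omega_{ij}\varepsilon_{ij}\rho(q_{ij}).$$ The weaving is statically flat if every equilibrium load on it is resolved by some $\omega\ge0$ (entrywise). Statics of a tensegrity. The tensegrity $(G,p,\varepsilon')$ has vertex $i$ placed at $p_i\in\mathbb{R}^2$, and its edge signs $\varepsilon'_{ij}$ are symmetric in $i,j$ ($+1$ for a strut, $-1$ for a cable). A load $f\in(\mathbb{R}^2)^n$ is an equilibrium load if $\sum_i f_i=0$ and $\sum_i\langle\rho(p_i),f_i\rangle=0$. A vector $\omega\in\mathbb{R}^E$ with $\omega\ge 0$ (entrywise) resolves $f$ if $-f_i=\sum_{j:\,ij\in E}\omega_{ij}\varepsilon'_{ij}(p_i-p_j)$ for every $i\in V$. The tensegrity is statically rigid if every equilibrium load is resolved by some $\omega\ge0$.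
   Formalization: A load on the weaving is resolved when f_i = Σ_j ω_ij ε_ij ρ(q_ij), without the factor 1/‖p_i‖; with that factor every resolved load satisfies Σ‖p_i‖f_i = 0 and the claim fails, e.g. for K4 at (3,4), (−3,4), (0,−5), (1,0). *)

(* Defs.v *)
From HB Require Import structures.
From mathcomp Require Import all_boot all_order all_algebra.
From mathcomp Require Import ring lra.
From mathcomp Require Import boolp classical_sets reals.

Set Implicit Arguments.
Unset Strict Implicit.
Unset Printing Implicit Defensive.

Import Order.TTheory GRing.Theory Num.Theory.
Local Open Scope ring_scope.
Local Open Scope classical_set_scope.

Section Plane.
Variable R : realType.
Implicit Types p q x : 'cV[R]_2.

Definition dot p q : R := \sum_k p k 0 * q k 0.

Definition rot90 p : 'cV[R]_2 := \col_k (if k == 0 then - p 1 0 else p 0 0).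

Definition det2 p q : R := \det (row_mx p q : 'M[R]_2).

(* For p <> 0 this is a line that misses the origin. *)
Definition line p : set 'cV[R]_2 := [set x | dot x p = 1].

(* Two lines of the plane are parallel when they coincide or do not meet. *)
Definition parallel (A B : set 'cV[R]_2) : Prop := A = B \/ A `&` B = set0.

Lemma dotE p q : dot p q = p 0 0 * q 0 0 + p 1 0 * q 1 0.
Proof.
rewrite /dot big_ord_recl big_ord1; congr (_ + p _ _ * q _ _); exact/val_inj.
Qed.

Lemma det2E p q : det2 p q = p 0 0 * q 1 0 - q 0 0 * p 1 0.
Proof.
rewrite /det2.
have : (row_mx p q : 'M[R]_2) =2 fun i j => if j == 0 then p i 0 else q i 0.
  move=> i j; rewrite mxE; case: splitP => k /= jk; rewrite [k]ord1 in jk *.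
    by rewrite (_ : (j == 0) = true) //; apply/eqP/val_inj.
  by rewrite (_ : (j == 0) = false) //; apply/negbTE/eqP => j0; rewrite j0 in jk.
move: (row_mx p q : 'M[R]_2) => A AE.
rewrite (expand_det_row _ 0) big_ord_recl big_ord1 /cofactor !det_mx11 !mxE !AE.
rewrite (_ : lift 0 0 = 1 :> 'I_2); last exact/val_inj.
rewrite (_ : lift 1 0 = 0 :> 'I_2); last exact/val_inj.
by rewrite /= expr0 expr1; ring.
Qed.

Lemma det2C p q : det2 q p = - det2 p q.
Proof. by rewrite !det2E; ring. Qed.

Lemma col2P p q : p 0 0 = q 0 0 -> p 1 0 = q 1 0 -> p = q.
Proof.
move=> h0 h1; apply/matrixP => i j; rewrite [j]ord1.
by case: (unliftP 0 i) => [k|] ->; rewrite ?[k]ord1 // (_ : lift 0 0 = 1) //;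
  exact/val_inj.
Qed.

Lemma det2_neq0 p q : p != 0 -> q != 0 -> ~ parallel (line p) (line q) ->
  det2 p q != 0.
Proof.
move=> p0 q0 npar; apply/eqP; rewrite det2E => d0; apply: npar.
have p2 : p 0 0 ^+ 2 + p 1 0 ^+ 2 != 0.
  apply: contra p0; rewrite paddr_eq0 ?sqr_ge0 // !sqrf_eq0 => /andP[/eqP a /eqP b].
  by apply/eqP/col2P; rewrite mxE.
pose c := dot p q / (p 0 0 ^+ 2 + p 1 0 ^+ 2).
have qcp : q = c *: p.
  have dc : q 0 0 * p 1 0 = p 0 0 * q 1 0 by apply/esym/eqP; rewrite -subr_eq0 d0.
  have e0 : q 0 0 * (p 0 0 ^+ 2 + p 1 0 ^+ 2) = dot p q * p 0 0.
    transitivity (p 0 0 ^+ 2 * q 0 0 + q 0 0 * p 1 0 * p 1 0); first by ring.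
    by rewrite dc dotE; ring.
  have e1 : q 1 0 * (p 0 0 ^+ 2 + p 1 0 ^+ 2) = dot p q * p 1 0.
    transitivity (p 0 0 * q 1 0 * p 0 0 + p 1 0 ^+ 2 * q 1 0); first by ring.
    by rewrite -dc dotE; ring.
  by apply: col2P; rewrite mxE /c mulrAC; apply/esym/(canLR (mulfK p2)).
have dotc x : dot x q = c * dot x p by rewrite qcp !dotE !mxE; ring.
have [c1|c1] := eqVneq c 1; [left|right].
  by apply/seteqP; split => x /=; rewrite /line /= dotc c1 mul1r.
apply/seteqP; split => x //= [] /=; rewrite /line /= dotc => -> /eqP.
by rewrite mulr1 (negbTE c1).
Qed.

End Plane.

Record sgraph (n : nat) := SGraph {
  adj :> rel 'I_n;
  adj_sym : symmetric adj;
  adj_irr : irreflexive adj }.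

(* Only the values of [weps] on ordered pairs of adjacent vertices matter:
   [weps i j] is +1 if line i passes over line j, and -1 if it passes under. *)
Record weaving (R : realType) (n : nat) := Weaving {
  wgraph : sgraph n;
  wp : 'I_n -> 'cV[R]_2;
  weps : 'I_n -> 'I_n -> R;
  wp_neq0 : forall i, wp i != 0;
  wlines_distinct : injective (fun i => line (wp i));
  wlines_nparallel : forall i j, wgraph i j ->
    ~ parallel (line (wp i)) (line (wp j));
  weps_sign : forall i j, wgraph i j -> weps i j = 1 \/ weps i j = -1;
  weps_anti : forall i j, wgraph i j -> weps j i = - weps i j }.

(* +1 is a strut, -1 a cable. *)
Record tensegrity (R : realType) (n : nat) := Tensegrity {
  tgraph : sgraph n;
  tp : 'I_n -> 'cV[R]_2;
  teps : 'I_n -> 'I_n -> R;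
  teps_sign : forall i j, tgraph i j -> teps i j = 1 \/ teps i j = -1;
  teps_sym : forall i j, tgraph i j -> teps j i = teps i j }.

Section Statics.
Variables (R : realType) (n : nat).
Implicit Types (p f : 'I_n -> 'cV[R]_2) (W : weaving R n) (T : tensegrity R n).

Definition equilibrium_load p f : Prop :=
  \sum_i f i = 0 /\ \sum_i dot (rot90 (p i)) (f i) = 0.

(* Vectors indexed by the edges, as functions on ordered pairs of vertices. *)
Definition edge_sym (G : sgraph n) (w : 'I_n -> 'I_n -> R) : Prop :=
  forall i j, G i j -> w i j = w j i.

Definition edge_ge0 (G : sgraph n) (w : 'I_n -> 'I_n -> R) : Prop :=
  forall i j, G i j -> 0 <= w i j.

Definition sfactor W i j : R := 1 / det2 (wp W i) (wp W j).

Definition crossing W i j : 'cV[R]_2 := sfactor W i j *: rot90 (wp W i - wp W j).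

(* A load on line i is f i = M *: u - (T / |p|) *: rot90 u, where p := wp W i,
   u := p / |p|, T is a vertical force and M a moment about an axis through the
   origin and orthogonal to the line.  At each crossing q, the line receives a
   vertical force w eps, so T = - \sum w eps and M = \sum w eps (dot u (rot90 q)).
   Since dot q p = 1, i.e. dot (rot90 u) (rot90 q) = 1 / |p|, these two equations
   say exactly that f i = \sum w eps (rot90 q), with no extra factor 1 / |p|
   (with that factor the f i of a resolved load would not sum to 0). *)
Definition weaving_resolves W (w : 'I_n -> 'I_n -> R) f : Prop :=
  forall i, f i =
    \sum_(j | wgraph W i j) (w i j * weps W i j) *: rot90 (crossing W i j).

Definition statically_flat W : Prop :=
  forall f, equilibrium_load (wp W) f ->
  exists w, [/\ edge_sym (wgraph W) w, edge_ge0 (wgraph W) w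
              & weaving_resolves W w f].

Definition tensegrity_resolves T (w : 'I_n -> 'I_n -> R) f : Prop :=
  forall i, - f i =
    \sum_(j | tgraph T i j) (w i j * teps T i j) *: (tp T i - tp T j).

Definition statically_rigid T : Prop :=
  forall f, equilibrium_load (tp T) f ->
  exists w, [/\ edge_sym (tgraph T) w, edge_ge0 (tgraph T) w
              & tensegrity_resolves T w f].

Definition polar_eps W i j : R := Num.sg (sfactor W i j) * weps W i j.

Lemma polar_eps_sign W i j : wgraph W i j ->
  polar_eps W i j = 1 \/ polar_eps W i j = -1.
Proof.
move=> ij; have d0 : sfactor W i j != 0.
  rewrite /sfactor mul1r invr_eq0 det2_neq0 ?wp_neq0 //.
  exact: wlines_nparallel ij.
rewrite /polar_eps; case: (weps_sign ij) => ->;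
  by case: (sgrP (sfactor W i j)) d0 => //; rewrite ?eqxx // => _ _;
     rewrite ?mulr1 ?mul1r ?mulN1r ?opprK; auto.
Qed.

Lemma polar_eps_sym W i j : wgraph W i j -> polar_eps W j i = polar_eps W i j.
Proof.
move=> ij; rewrite /polar_eps (weps_anti ij).
have -> : sfactor W j i = - sfactor W i j.
  by rewrite /sfactor det2C invrN mulrN.
by rewrite sgrN mulrNN.
Qed.

Definition polar_tensegrity W : tensegrity R n :=
  Tensegrity (wp W) (@polar_eps_sign W) (@polar_eps_sym W).

End Statics.

(* Main.v *)
Require Import Defs.
From mathcomp Require Import all_boot all_order all_algebra reals.

(** The two notions of equilibrium load coincide, since both are written in
    terms of the same points [p i], so only the ways of resolving a load have to
    be compared.  A crossing point is itself a quarter turn of an edge vector,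
    [q = s *: rot90 (p i - p j)], and turning it once more gives
    [- s *: (p i - p j)].  Hence the reaction of the weaving at the crossing of
    lines [i] and [j] acts along the bar [ij] of the tensegrity, and the factor
    [s] splits as follows: its sign turns the antisymmetric over/under signs into
    the symmetric strut/cable signs, and its absolute value rescales the stress.
    So [w] resolves a load on the weaving exactly when [w * `|s|] resolves it on
    the polar tensegrity ([weaving_resolves_polar]).  Adjacent lines are not
    parallel, so [`|s|] is positive on every edge, and it is symmetric;
    multiplying or dividing by it therefore preserves symmetric nonnegative
    stresses and gives the two implications. *)

Set Implicit Arguments.
Unset Strict Implicit.
Unset Printing Implicit Defensive.

Import Order.TTheory GRing.Theory Num.Theory.
Local Open Scope ring_scope.

Lemma rot90_rot90 (R : realType) (a : R) (v : 'cV[R]_2) :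
  rot90 (a *: rot90 v) = - (a *: v).
Proof. by apply: col2P; rewrite !mxE //= mulrN. Qed.

Section Polarity.
Variables (R : realType) (n : nat) (W : weaving R n).

Lemma sfactorC i j : sfactor W j i = - sfactor W i j.
Proof. by rewrite /sfactor det2C invrN mulrN. Qed.

Lemma sfactor_neq0 i j : wgraph W i j -> sfactor W i j != 0.
Proof.
move=> ij; rewrite /sfactor mul1r invr_eq0 det2_neq0 ?wp_neq0 //.
exact: wlines_nparallel ij.
Qed.

(** Writing [s = sg s * `|s|] moves the sign of [s] into the polar edge sign and
    leaves [`|s|] as the ratio of the two stresses. *)
Lemma weaving_resolves_polar (w w' : 'I_n -> 'I_n -> R) f :
    (forall i j, wgraph W i j -> w' i j = w i j * `|sfactor W i j|) ->
  weaving_resolves W w f <-> tensegrity_resolves (polar_tensegrity W) w' f.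
Proof.
move=> w'E.
have sumE i : \sum_(j | wgraph W i j)
      (w i j * weps W i j) *: rot90 (crossing W i j) =
    - \sum_(j | wgraph W i j)
      (w' i j * polar_eps W i j) *: (wp W i - wp W j).
  rewrite -sumrN; apply: eq_bigr => j ij.
  rewrite /crossing rot90_rot90 scalerN scalerA w'E // /polar_eps.
  rewrite {1}[sfactor W i j]numEsg; congr (- (_ *: _)).
  by rewrite [RHS]mulrA -[in RHS](mulrA (w i j)) [in RHS](mulrC `|_|) mulrAC -!mulrA.
split=> res i; first by rewrite res sumE opprK.
by rewrite sumE -res opprK.
Qed.

End Polarity.

Theorem theorem4p10 (R : realType) (n : nat) (W : weaving R n) :
  statically_flat W <-> statically_rigid (polar_tensegrity W).
Proof.
have normC i j : `|sfactor W j i| = `|sfactor W i j|.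
  by rewrite sfactorC normrN.
split=> resolvable f /resolvable[w [w_sym w_ge0 w_res]].
- exists (fun i j => w i j * `|sfactor W i j|); split.
  + by move=> i j ij; rewrite w_sym // normC.
  + by move=> i j ij; rewrite mulr_ge0 ?w_ge0.
  + exact/(weaving_resolves_polar (w := w)).
- exists (fun i j => w i j / `|sfactor W i j|); split.
  + by move=> i j ij; rewrite w_sym // normC.
  + by move=> i j ij; rewrite divr_ge0 ?w_ge0.
  + apply/(weaving_resolves_polar (w' := w)) => // i j ij.
    by rewrite divfK // normr_eq0 sfactor_neq0.
Qed.
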